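(* Let $p\in\mathbb{H}^2$ and let $H_p$ be the set of all geodesics through $p$. For each $L\in H_p$ fix an isometry $\psi_L$ from $\mathbb{H}^2$ onto the upper half-plane model $\{(x,y):y>0\}$ with $\psi_L(L)=\{x=0\}$; for $t>0$ let $L'=L'_t=\psi_L^{-1}(\{x=t\})$ be the geodesic corresponding to the vertical line at Euclidean distance $t$ from $L$. A convex body $K$ with $p$ in its interior is determined by the orthogonal projection lengths on the lines $L$ together with the non-orthogonal projection lengths on the lines $L'$; that is: let $K_1,K_2\subset\mathbb{H}^2$ be convex bodies containing $p$ in their interiors, and let $t>0$ be such that, for each $i\in\{1,2\}$ and every $L\in H_p$, the geodesic $L'$ intersects both supporting geodesics of $K_i$ that are perpendicular to $L$. If $$|P_L(K_1)|=|P_L(K_2)|\quad\text{and}\quad |P_{L'}(K_1)|=|P_{L'}(K_2)|\qquad\text{for every } L\in H_p,$$ where $P_L(K)$ is the orthogonal projection of $K$ on $L$ and $P_{L'}(K)$ is the (non-orthogonal) projection of $K$ on $L'$ along the geodesics perpendicular to $L$, then $K_1=K_2$.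
   Context: $\mathbb{H}^2$ is the hyperbolic plane. A body is a compact set $K\subset\mathbb{H}^2$ equal to the closure of its non-empty interior. It is convex if its boundary cannot be intersected by a geodesic in more than two points (with the exception that an arc of a geodesic may be part of the boundary). A supporting geodesic of $K$ is a geodesic that has only one common point with $\partial K$, or has a complete arc in common with $\partial K$. For each geodesic $L$ there are exactly two supporting geodesics of $K$ perpendicular to $L$ when $L$ passes through an interior point of $K$. For a geodesic $L$ and a point $x\in\mathbb{H}^2$, $n_L(x)$ denotes the geodesic through $x$ perpendicular to $L$. The orthogonal projection of $K$ on $L$ is $P_L(K)=\{x\in L: K\cap n_L(x)\neq\emptyset\}$. For $L'$ associated with $L$ as in the claim, the non-orthogonal projection is $P_{L'}(K)=\{x\in L' : K\cap n_L(x)\neq\emptyset\}$; under the stated hypothesis on $t$ it is the segment of $L'$ between the two supporting geodesics of $K$ perpendicular to $L$. Here $|\cdot|$ denotes hyperbolic length of a segment. *)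

(* Defs.v *)
From HB Require Import structures.
From mathcomp Require Import all_boot all_order all_algebra.
From mathcomp Require Import all_classical all_reals all_analysis.
Import Order.TTheory GRing.Theory Num.Theory.
Import numFieldNormedType.Exports.

Set Implicit Arguments.
Unset Strict Implicit.
Unset Printing Implicit Defensive.

Local Open Scope classical_set_scope.
Local Open Scope ring_scope.

(* The hyperbolic plane is the upper half-plane {(x, y) : y > 0}. As a set_type
   it carries the subtype topology from R * R, which is also the topology of
   the hyperbolic distance hdist. *)
Definition half_plane (R : realType) : set (R * R) := [set z | 0 < z.2].
Arguments half_plane : clear implicits.

Definition H2 (R : realType) : Type := set_type (half_plane R).

Definition xco (R : realType) (z : H2 R) : R := (set_val z).1.
Definition yco (R : realType) (z : H2 R) : R := (set_val z).2.

Definition arcosh (R : realType) (u : R) : R := ln (u + Num.sqrt (u ^+ 2 - 1)).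

Definition hdist (R : realType) (z w : H2 R) : R :=
  arcosh (1 + ((xco z - xco w) ^+ 2 + (yco z - yco w) ^+ 2)
              / (2 * yco z * yco w)).

Definition hisometry (R : realType) (f : H2 R -> H2 R) : Prop :=
  bijective f /\ forall z w, hdist (f z) (f w) = hdist z w.

Inductive geodesic (R : realType) : Type :=
| Vertical of R
| Semicircle of R & {posnum R}.
Arguments Vertical {R} _.
Arguments Semicircle {R} _ _.

Definition points (R : realType) (G : geodesic R) : set (H2 R) :=
  match G with
  | Vertical c => [set z | xco z = c]
  | Semicircle c r => [set z | (xco z - c) ^+ 2 + yco z ^+ 2 = r%:num ^+ 2]
  end.

(* A nonzero tangent vector at z to the geodesic G passing through z. *)
Definition tangent (R : realType) (G : geodesic R) (z : H2 R) : R * R :=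
  match G with
  | Vertical c => (0, 1)
  | Semicircle c r => (yco z, c - xco z)
  end.

(* The Riemannian metric (dx^2 + dy^2) / y^2. *)
Definition hinner (R : realType) (z : H2 R) (u v : R * R) : R :=
  (u.1 * v.1 + u.2 * v.2) / yco z ^+ 2.

Definition perpendicular (R : realType) (G L : geodesic R) : Prop :=
  exists z, [/\ points G z, points L z & hinner z (tangent G z) (tangent L z) = 0].

(* The geodesic segment with end points a and b: H^2 is uniquely geodesic. *)
Definition hsegment (R : realType) (a b : H2 R) : set (H2 R) :=
  [set z | hdist a z + hdist z b = hdist a b].

Definition is_arc (R : realType) (A : set (H2 R)) : Prop :=
  exists a b, a <> b /\ A = hsegment a b.

(* Junk value 0 if A is not a geodesic segment. *)
Definition hlength (R : realType) (A : set (H2 R)) : R :=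
  xget 0 [set l | exists a b, A = hsegment a b /\ l = hdist a b].

Definition boundary (T : topologicalType) (A : set T) : set T :=
  closure A `\` interior A.

Definition body (R : realType) (K : set (H2 R)) : Prop :=
  [/\ compact K, interior K !=set0 & K = closure (interior K)].

Definition convex_body (R : realType) (K : set (H2 R)) : Prop :=
  body K /\
  forall G : geodesic R,
    (exists a b, points G `&` boundary K `<=` [set a; b]) \/
    is_arc (points G `&` boundary K).

Definition supporting (R : realType) (K : set (H2 R)) (G : geodesic R) : Prop :=
  (exists a, points G `&` boundary K = [set a]) \/
  is_arc (points G `&` boundary K).

(* n_L(x): exactly one geodesic N through x is perpendicular to L, so the union
   below is the set of its points. *)
Definition normal (R : realType) (L : geodesic R) (x : H2 R) : set (H2 R) :=
  \bigcup_(N in [set N | points N x /\ perpendicular N L]) points N.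

(* The projection of K on the set A along the geodesics perpendicular to L. *)
Definition projection_along (R : realType) (L : geodesic R)
    (A K : set (H2 R)) : set (H2 R) :=
  [set x | A x /\ (K `&` normal L x) !=set0].

Definition orthogonal_projection (R : realType) (L : geodesic R)
    (K : set (H2 R)) : set (H2 R) :=
  projection_along L (points L) K.

(* L'_t, given the isometry f = psi_L that maps L onto {x = 0}. *)
Definition companion (R : realType) (f : H2 R -> H2 R) (t : R) : set (H2 R) :=
  f @^-1` points (Vertical t).

(* Main.v *)
Require Import Defs.
From mathcomp Require Import all_boot all_order all_algebra.
From mathcomp Require Import all_classical all_reals all_analysis.
From mathcomp Require Import ring lra.
Import Order.TTheory GRing.Theory Num.Theory.
Import numFieldNormedType.Exports.
Set Implicit Arguments.
Unset Strict Implicit.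
Unset Printing Implicit Defensive.
Local Open Scope classical_set_scope.
Local Open Scope ring_scope.

(** Write x, y for the half-plane coordinates.  In the coordinates
    (u, v) = (x, x^2 + y^2) the half-plane becomes the region v > u^2 and every
    geodesic becomes a chord of it, the zero set of an affine form in (u, v):
    this is the projective (Klein) model with a parabola as the circle at
    infinity.  Convexity and separation are affine matters there.

    Let f be an isometry that carries a geodesic L to the axis {x = 0}.  The
    geodesics perpendicular to the axis are the half circles about 0, so the
    perpendiculars to L are the level sets of foot f z = |f z|^2
    ([normalE]); this is so for every f, since the foot of a perpendicular is
    the closest point of L ([foot_closest]).  Moreover foot f is a quotient of
    two positive affine forms ([foot_projective]), so it is continuous and
    monotone along chords.

    A convex body in the sense of few boundary points on each geodesic is convex
    in the usual sense ([convex_body_chord]): if the chord from an interior point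
    q to a point of K left K, its geodesic would carry two boundary points after
    q and, by compactness, one before q; being more than two they would lie on an
    arc of boundary points, which would contain q.

    Hence foot f maps K onto an interval [m, M], and m < M because interior
    points have no extreme foot.  The geodesic perpendicular to L at level m
    supports K, so it meets the companion line {x = t}, that is t^2 < m.  The
    projections of K are then the segments of {x = 0} and of {x = t} over
    [m, M], of lengths
      (1/2) ln (M / m)    and    (1/2) ln ((M - t^2) / (m - t^2)).
    For m < M and t <> 0 these two numbers determine m and M.  So for each L
    through p the two bodies meet the same perpendiculars to L.

    Finally, if some x in K2 were outside K1, a geodesic G would separate x from
    K1; G is perpendicular to a geodesic L through p, and the perpendicular to L
    through x, which cannot cross G, would miss K1 ([projections_determine]). *)

(** * Points and the hyperbolic distance *)

Lemma yco_gt0 (R : realType) (z : H2 R) : 0 < yco z.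
Proof. by have := set_valP z. Qed.

Lemma H2_ext (R : realType) (z w : H2 R) :
  xco z = xco w -> yco z = yco w -> z = w.
Proof.
move=> ex ey; apply: val_inj; rewrite [LHS]surjective_pairing.
by rewrite [RHS]surjective_pairing; congr (_, _).
Qed.

Lemma hpoint_subproof (R : realType) (x y : R) :
  (x, if 0 < y then y else 1) \in half_plane R.
Proof. by rewrite inE /half_plane /=; case: ifP. Qed.

(** The value 1 at [y <= 0] makes the constructor total. *)
Definition hpoint (R : realType) (x y : R) : H2 R :=
  SigSub (hpoint_subproof x y).

Lemma xco_hpoint (R : realType) (x y : R) : xco (hpoint x y) = x.
Proof. by []. Qed.

Lemma yco_hpoint (R : realType) (x y : R) : 0 < y -> yco (hpoint x y) = y.
Proof. by rewrite /yco /= => ->. Qed.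

(** The hyperbolic cosine of the distance: unlike the distance, it is rational in
    the coordinates. *)
Definition coshd (R : realType) (z w : H2 R) : R :=
  ((xco z - xco w) ^+ 2 + yco z ^+ 2 + yco w ^+ 2) / (2 * yco z * yco w).

Lemma hdistE (R : realType) (z w : H2 R) : hdist z w = arcosh (coshd z w).
Proof.
rewrite /hdist /coshd; congr arcosh; have := yco_gt0 z; have := yco_gt0 w.
by move=> ? ?; field; rewrite !gt_eqF.
Qed.

Lemma coshdE (R : realType) (z w : H2 R) :
  coshd z w = 1 + ((xco z - xco w) ^+ 2 + (yco z - yco w) ^+ 2) / (2 * yco z * yco w).
Proof.
rewrite /coshd; have := yco_gt0 z; have := yco_gt0 w.
by move=> ? ?; field; rewrite !gt_eqF.
Qed.

Lemma coshd_ge1 (R : realType) (z w : H2 R) : 1 <= coshd z w.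
Proof.
by rewrite coshdE lerDl divr_ge0 ?addr_ge0 ?sqr_ge0// !mulr_ge0// ltW// yco_gt0.
Qed.

Lemma ler_arcosh (R : realType) (u v : R) : 1 <= u -> 1 <= v ->
  (arcosh u <= arcosh v) = (u <= v).
Proof.
have pos (x : R) : 1 <= x -> x + Num.sqrt (x ^+ 2 - 1) \is Num.pos.
  by move=> x1; rewrite posrE ltr_pwDl ?sqrtr_ge0//; lra.
move=> u1 v1; apply/idP/idP => uv; last first.
  rewrite /arcosh ler_ln ?pos//.
  apply: lerD => //; apply: ler_wsqrtr; nra.
rewrite leNgt; apply/negP => vu; move: uv; apply/negP; rewrite -ltNge.
rewrite /arcosh ltr_ln ?pos//.
apply: ltr_leD => //; apply: ler_wsqrtr; nra.
Qed.

Lemma arcosh_inj (R : realType) (u v : R) : 1 <= u -> 1 <= v ->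
  arcosh u = arcosh v -> u = v.
Proof.
move=> u1 v1 e; apply/eqP.
by rewrite eq_le -(ler_arcosh u1 v1) -(ler_arcosh v1 u1) e lexx.
Qed.

(** The argument is the hyperbolic cosine of [ln s]. *)
Lemma arcosh_ln (R : realType) (s : R) : 0 < s ->
  arcosh ((s + s^-1) / 2) = `|ln s|.
Proof.
move=> s0; rewrite /arcosh.
have -> : ((s + s^-1) / 2) ^+ 2 - 1 = ((s - s^-1) / 2) ^+ 2.
  by field; rewrite gt_eqF.
rewrite sqrtr_sqr.
have [s1|s1] := leP 1 s.
  have : s^-1 <= 1 by rewrite invf_le1.
  move=> si; rewrite ger0_norm; last by lra.
  rewrite ger0_norm ?ln_ge0//; congr ln; lra.
have : 1 < s^-1 by rewrite invf_gt1.
move=> si; rewrite ler0_norm; last by lra.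
rewrite ler0_norm ?ln_le0 ?(ltW s1)// -lnV ?posrE//; congr ln; lra.
Qed.

Lemma hdist_vertical (R : realType) (z w : H2 R) : xco z = xco w ->
  hdist z w = `|ln (yco z) - ln (yco w)|.
Proof.
move=> e; have y0 := yco_gt0 z; have y1 := yco_gt0 w.
rewrite -ln_div ?posrE// -arcosh_ln ?divr_gt0// hdistE /coshd e; congr arcosh.
by field; rewrite !gt_eqF.
Qed.

(** Among the points at the height of [w], the nearest to [z] is the one straight
    above or below [z].  Together with the triangle inequality on the line of
    logarithmic heights, this shows that vertical segments are the only shortest
    ones between their ends. *)
Lemma hdist_ge_ln (R : realType) (z w : H2 R) :
  `|ln (yco z) - ln (yco w)| <= hdist z w ?= iff (xco z == xco w).
Proof.
have y0 := yco_gt0 z; have y1 := yco_gt0 w.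
pose w' := hpoint (xco z) (yco w).
have yw' : yco w' = yco w by rewrite yco_hpoint.
rewrite -yw' -hdist_vertical //.
have e : coshd z w = coshd z w' + (xco z - xco w) ^+ 2 / (2 * yco z * yco w).
  by rewrite /coshd yw' xco_hpoint; field; rewrite !gt_eqF.
have d0 : 0 < (2 * yco z * yco w)^-1 by rewrite invr_gt0 !mulr_gt0.
split.
  rewrite !hdistE ler_arcosh ?coshd_ge1// e lerDl mulr_ge0 ?sqr_ge0// ltW//.
apply/eqP/eqP => [|ez]; last by rewrite !hdistE e ez subrr expr0n mul0r addr0.
rewrite !hdistE => /arcosh_inj -/(_ (coshd_ge1 _ _) (coshd_ge1 _ _)).
rewrite e => /eqP; rewrite eq_sym -subr_eq0 addrC addKr mulf_eq0 (gt_eqF d0) orbF.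
by rewrite sqrf_eq0 subr_eq0 => /eqP.
Qed.

Lemma hdistC (R : realType) (z w : H2 R) : hdist z w = hdist w z.
Proof.
rewrite !hdistE /coshd; congr arcosh; have := yco_gt0 z; have := yco_gt0 w.
by move=> ? ?; field; rewrite !gt_eqF.
Qed.

Lemma hsegmentC (R : realType) (a b : H2 R) : hsegment a b = hsegment b a.
Proof.
apply/seteqP; split=> z;
  by rewrite /hsegment /= (hdistC a b) (hdistC a z) (hdistC z b) addrC.
Qed.

Lemma hsegment_ends (R : realType) (a b : H2 R) :
  hsegment a b a /\ hsegment a b b.
Proof.
have refl (c : H2 R) : hdist c c = 0 by rewrite hdist_vertical// subrr normr0.
by rewrite /hsegment /= !refl add0r addr0.
Qed.

Lemma hsegment_vertical (R : realType) (a b z : H2 R) :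
  xco a = xco b -> yco a <= yco b ->
  hsegment a b z <-> [/\ xco z = xco a, yco a <= yco z & yco z <= yco b].
Proof.
move=> eab lab; have ya := yco_gt0 a; have yb := yco_gt0 b; have yz := yco_gt0 z.
have ln_mono (u v : H2 R) : (yco u <= yco v) = (ln (yco u) <= ln (yco v)).
  by rewrite ler_ln// posrE yco_gt0.
have ll : ln (yco a) <= ln (yco b) by rewrite -ln_mono.
rewrite /hsegment /= (hdist_vertical eab).
rewrite [`|ln (yco a) - _|]ler0_norm; last by lra.
split=> [dz|[xz az zb]]; last first.
  rewrite !hdist_vertical ?xz //; move: az zb; rewrite !ln_mono => az zb.
  rewrite !ler0_norm; lra.
have [i1 e1] := hdist_ge_ln a z; have [i2 e2] := hdist_ge_ln z b.
have [n1 n2] : - (ln (yco a) - ln (yco z)) <= `|ln (yco a) - ln (yco z)| /\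
   - (ln (yco z) - ln (yco b)) <= `|ln (yco z) - ln (yco b)|.
  by rewrite -!(normrN (_ - _)) !ler_norm.
have f1 : - (ln (yco a) - ln (yco z)) = `|ln (yco a) - ln (yco z)| by lra.
have f2 : - (ln (yco z) - ln (yco b)) = `|ln (yco z) - ln (yco b)| by lra.
split.
- apply/eqP; rewrite eq_sym -e1; apply/eqP; lra.
- rewrite ln_mono; have := normr_ge0 (ln (yco a) - ln (yco z)); lra.
- rewrite ln_mono; have := normr_ge0 (ln (yco z) - ln (yco b)); lra.
Qed.

(** * Isometries that straighten a geodesic *)

(** When [f] carries a geodesic [L] to the axis {x = 0}, this is the position of
    the foot of the perpendicular from [z] to [L], read on the axis and squared.
    The square, unlike the radius, is a rational function. *)
Definition foot (R : realType) (f : H2 R -> H2 R) (z : H2 R) : R :=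
  xco (f z) ^+ 2 + yco (f z) ^+ 2.

Definition straightens (R : realType) (f : H2 R -> H2 R) (L : geodesic R) :=
  hisometry f /\ f @` points L = points (Vertical 0).

(** An affine form in the coordinates (x, x^2 + y^2), given by its three
    coefficients.  The geodesics are zero sets of such forms. *)
Definition affine (R : realType) (k : R * R * R) (z : H2 R) : R :=
  k.1.1 * (xco z ^+ 2 + yco z ^+ 2) + k.1.2 * xco z + k.2.

Lemma foot_gt0 (R : realType) (f : H2 R -> H2 R) (z : H2 R) : 0 < foot f z.
Proof. by rewrite /foot ltr_wpDl ?sqr_ge0// exprn_gt0// yco_gt0. Qed.

Lemma isometry_coshd (R : realType) (f : H2 R -> H2 R) (z w : H2 R) :
  hisometry f -> coshd (f z) (f w) = coshd z w.
Proof. by case=> _ fd; apply: arcosh_inj; rewrite ?coshd_ge1// -!hdistE fd. Qed.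

Lemma isometry_surj (R : realType) (f : H2 R -> H2 R) (w : H2 R) :
  hisometry f -> exists z, f z = w.
Proof. by case=> -[g fK gK] _; exists (g w). Qed.

Lemma isometry_inj (R : realType) (f : H2 R -> H2 R) :
  hisometry f -> injective f.
Proof. by case=> /bij_inj. Qed.

Lemma straightensP (R : realType) (f : H2 R -> H2 R) (L : geodesic R) z :
  straightens f L -> points L z <-> xco (f z) = 0.
Proof.
case=> fi fL; have e : [set f x | x in points L] (f z) <-> points (Vertical 0) (f z).
  by rewrite fL.
split=> [Lz|/e[w Lw /(isometry_inj fi)<-]//]; apply/e; by exists z.
Qed.

Lemma foot_on (R : realType) (f : H2 R -> H2 R) (L : geodesic R) z :
  straightens f L -> points L z -> foot f z = yco (f z) ^+ 2.
Proof. by move=> fL /(straightensP _ fL) e; rewrite /foot e expr0n add0r. Qed.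

Lemma foot_surj (R : realType) (f : H2 R -> H2 R) (L : geodesic R) s :
  straightens f L -> 0 < s -> exists2 z, points L z & foot f z = s.
Proof.
move=> fL s0; have [z fz] := isometry_surj (hpoint 0 (Num.sqrt s)) fL.1.
have Lz : points L z by apply/(straightensP _ fL); rewrite fz.
exists z => //; rewrite (foot_on fL Lz) fz yco_hpoint ?sqrtr_gt0//.
by rewrite sqr_sqrtr// ltW.
Qed.

Lemma foot_inj (R : realType) (f : H2 R -> H2 R) (L : geodesic R) z w :
  straightens f L -> points L z -> points L w -> foot f z = foot f w -> z = w.
Proof.
move=> fL Lz Lw; rewrite !(foot_on fL)// => /eqP.
rewrite eqrXn2 ?ltW ?yco_gt0// => /eqP e; apply: (isometry_inj fL.1).
apply: H2_ext => //.
by rewrite ((straightensP z fL).1 Lz) ((straightensP w fL).1 Lw).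
Qed.

Lemma foot_le_on (R : realType) (f : H2 R -> H2 R) (L : geodesic R) z w :
  straightens f L -> points L z -> points L w ->
  (foot f z <= foot f w) = (yco (f z) <= yco (f w)).
Proof.
by move=> fL Lz Lw; rewrite !(foot_on fL)// ler_pXn2r ?nnegrE ?(ltW (yco_gt0 _)).
Qed.

Lemma isometry_hsegment (R : realType) (f : H2 R -> H2 R) (a b z : H2 R) :
  hisometry f -> hsegment (f a) (f b) (f z) <-> hsegment a b z.
Proof. by case=> _ fd; rewrite /hsegment /= !fd. Qed.

Lemma hsegment_foot (R : realType) (f : H2 R -> H2 R) (L : geodesic R) a b z :
  straightens f L -> points L a -> points L b -> foot f a <= foot f b ->
  hsegment a b z <-> [/\ points L z, foot f a <= foot f z & foot f z <= foot f b].
Proof.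
move=> fL La Lb; rewrite (foot_le_on fL)// => lab.
rewrite -(isometry_hsegment a b z fL.1).
move/(straightensP _ fL): (La) => ea; move/(straightensP _ fL): (Lb) => eb.
rewrite hsegment_vertical ?ea ?eb//; split.
  by move=> [/(straightensP _ fL) Lz h1 h2]; rewrite !(foot_le_on fL).
move=> [Lz]; rewrite !(foot_le_on fL)// => h1 h2; split=> //.
exact/(straightensP _ fL).
Qed.

(** Multiplied by y, the hyperbolic cosine of the distance to a fixed point is an
    affine form in (x, x^2 + y^2), so the quotient of two such cosines is
    projective.  Measured in the image of [f], from the preimages of (0, 1) and
    (0, 2), that quotient is 2 (W + 1) / (W + 4) with W the foot, and solving for
    W keeps it projective. *)
Lemma foot_projective (R : realType) (f : H2 R -> H2 R) : hisometry f ->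
  exists A B : R * R * R, forall z : H2 R,
    [/\ 0 < affine A z, 0 < affine B z & foot f z = affine A z / affine B z].
Proof.
move=> fi; have [a fa] := isometry_surj (hpoint 0 1) fi.
have [b fb] := isometry_surj (hpoint 0 2) fi.
(* [k c m] is the affine form 2 m y cosh d(z, c). *)
pose k (c : H2 R) (m : R) : R * R * R :=
  (m / yco c, m * (- 2 * xco c) / yco c, m * (xco c ^+ 2 + yco c ^+ 2) / yco c).
pose sub (k l : R * R * R) : R * R * R :=
  (k.1.1 - l.1.1, k.1.2 - l.1.2, k.2 - l.2).
exists (sub (k a 4) (k b 2)), (sub (k b 2) (k a 1)) => z.
have affB u v : affine (sub u v) z = affine u z - affine v z.
  by rewrite /affine /sub /=; ring.
have ya := yco_gt0 a; have yb := yco_gt0 b; have yz := yco_gt0 z.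
have yf := yco_gt0 (f z).
have kE c m : affine (k c m) z = m * 2 * yco z * coshd z c.
  by rewrite /affine /k /coshd /=; have := yco_gt0 c => yc; field; rewrite !gt_eqF.
rewrite !affB !kE -!(isometry_coshd z _ fi) fa fb /coshd !yco_hpoint// !xco_hpoint.
rewrite !subr0.
set W := foot f z; have W0 : 0 < W := foot_gt0 f z.
have eW : xco (f z) ^+ 2 + yco (f z) ^+ 2 = W by [].
rewrite eW.
set q := yco z / yco (f z); have q0 : 0 < q by rewrite divr_gt0.
have -> : 4 * 2 * yco z * ((W + 1 ^+ 2) / (2 * yco (f z) * 1)) -
  2 * 2 * yco z * ((W + 2 ^+ 2) / (2 * yco (f z) * 2)) = 3 * W * q.
  by rewrite /q; field; rewrite !gt_eqF.
have -> : 2 * 2 * yco z * ((W + 2 ^+ 2) / (2 * yco (f z) * 2)) -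
  1 * 2 * yco z * ((W + 1 ^+ 2) / (2 * yco (f z) * 1)) = 3 * q.
  by rewrite /q; field; rewrite !gt_eqF.
clearbody q.
by split; rewrite ?mulr_gt0 ?mulr_gt0 ?ltr0n//; field; rewrite !gt_eqF.
Qed.

(** The inversion in the circle of squared radius [k] about the ideal point
    [(e, 0)], followed by the horizontal translation that takes [e] to [s]. *)
Definition inversion (R : realType) (e k s : R) (z : H2 R) : H2 R :=
  let n := (xco z - e) ^+ 2 + yco z ^+ 2 in
  hpoint (s + k * (xco z - e) / n) (k * yco z / n).

Lemma inversion_norm_gt0 (R : realType) (e : R) (z : H2 R) :
  0 < (xco z - e) ^+ 2 + yco z ^+ 2.
Proof. by rewrite ltr_wpDl ?sqr_ge0// exprn_gt0// yco_gt0. Qed.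

Lemma yco_inversion (R : realType) (e k s : R) (z : H2 R) : 0 < k ->
  yco (inversion e k s z) = k * yco z / ((xco z - e) ^+ 2 + yco z ^+ 2).
Proof.
by move=> k0; rewrite yco_hpoint// divr_gt0 ?mulr_gt0 ?yco_gt0 ?inversion_norm_gt0.
Qed.

Lemma xco_inversion (R : realType) (e k s : R) (z : H2 R) :
  xco (inversion e k s z) = s + k * (xco z - e) / ((xco z - e) ^+ 2 + yco z ^+ 2).
Proof. by []. Qed.

Lemma inversionK (R : realType) (e k s : R) : 0 < k ->
  cancel (inversion e k s) (inversion s k e).
Proof.
move=> k0 z; have := inversion_norm_gt0 e z; have yz := yco_gt0 z.
set n := (_ + _) => n0.
have xi : xco (inversion e k s z) = s + k * (xco z - e) / n by [].
have yi : yco (inversion e k s z) = k * yco z / n by rewrite yco_inversion.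
have e2 : (xco (inversion e k s z) - s) ^+ 2 + yco (inversion e k s z) ^+ 2 = k ^+ 2 / n.
  rewrite yco_inversion// xco_inversion -/n [s + _]addrC addrK.
  have -> : (k * (xco z - e) / n) ^+ 2 + (k * yco z / n) ^+ 2 =
    k ^+ 2 * ((xco z - e) ^+ 2 + yco z ^+ 2) / n ^+ 2 by field; rewrite gt_eqF.
  by rewrite -/n; field; rewrite gt_eqF.
clearbody n; apply: H2_ext.
  rewrite [LHS]xco_inversion e2 xi [s + _]addrC addrK.
  by field; rewrite !gt_eqF.
rewrite [LHS]yco_inversion// e2 yi.
by field; rewrite !gt_eqF.
Qed.

Lemma inversion_isometry (R : realType) (e k s : R) : 0 < k ->
  hisometry (inversion e k s).
Proof.
move=> k0; split; first by exists (inversion s k e); exact: inversionK.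
move=> z w; rewrite !hdistE; congr arcosh; rewrite !coshdE.
rewrite !xco_inversion !yco_inversion//.
have := inversion_norm_gt0 e z; have := inversion_norm_gt0 e w.
have := yco_gt0 z; have := yco_gt0 w => yw yz nw nz.
by field; rewrite !gt_eqF.
Qed.

(** Compose with the inversion in the unit circle, which preserves the axis.  This
    reverses the orientation of [L], so two distinct feet may be taken in either
    order. *)
Lemma foot_inv (R : realType) (f : H2 R -> H2 R) (L : geodesic R) :
  straightens f L ->
  exists2 g, straightens g L & forall z, foot g z = (foot f z)^-1.
Proof.
move=> fL; have fi := fL.1; exists (inversion 0 1 0 \o f).
  split.
    have [/(bij_comp _) b d] := fi; have [/b b' d'] := inversion_isometry 0 0 (@ltr01 R).
    by split=> // z w /=; rewrite d' d.
  apply/seteqP; split=> [_ [z /(straightensP _ fL) e <-]|w /= w0].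
    by rewrite /= xco_inversion e subrr mulr0 mul0r addr0.
  have [z fz] := isometry_surj (inversion 0 1 0 w) fi.
  exists z; last by rewrite /= fz inversionK.
  by apply/(straightensP _ fL); rewrite fz xco_inversion w0 subrr mulr0 mul0r addr0.
move=> z; rewrite /foot /= xco_inversion yco_inversion// subr0 add0r.
have := inversion_norm_gt0 0 (f z); rewrite subr0.
set n := (X in 0 < X) => n0.
have -> : (1 * xco (f z) / n) ^+ 2 + (1 * yco (f z) / n) ^+ 2 =
  (xco (f z) ^+ 2 + yco (f z) ^+ 2) / n ^+ 2 by field; rewrite gt_eqF.
by rewrite -/n; field; rewrite gt_eqF.
Qed.

(** For a half circle, this is the squared ratio of the Euclidean distances to its
    two ideal end points: the perpendiculars are its circles of Apollonius. *)
Definition foot_formula (R : realType) (L : geodesic R) (z : H2 R) : R :=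
  match L with
  | Vertical c => (xco z - c) ^+ 2 + yco z ^+ 2
  | Semicircle c r => ((xco z - (c + r%:num)) ^+ 2 + yco z ^+ 2) /
                      ((xco z - (c - r%:num)) ^+ 2 + yco z ^+ 2)
  end.

(** A half circle is straightened by an inversion about one of its ideal end
    points. *)
Lemma straighten_exists (R : realType) (L : geodesic R) :
  exists2 f, straightens f L & forall z, foot f z = foot_formula L z.
Proof.
case: L => [c|c r].
  pose f (z : H2 R) := hpoint (xco z - c) (yco z).
  pose g (z : H2 R) := hpoint (xco z + c) (yco z).
  have yf z : yco (f z) = yco z by rewrite yco_hpoint// yco_gt0.
  have yg z : yco (g z) = yco z by rewrite yco_hpoint// yco_gt0.
  exists f; last by move=> z; rewrite /foot yf.
  have fK : cancel f g.
    by move=> z; apply: H2_ext; rewrite ?yg ?yf// xco_hpoint xco_hpoint subrK.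
  have gK : cancel g f.
    by move=> z; apply: H2_ext; rewrite ?yf ?yg// xco_hpoint xco_hpoint addrK.
  split; first split; first by exists g.
    move=> z w; rewrite !hdistE /coshd !yf !xco_hpoint; congr (arcosh (_ / _)).
    by congr (_ + _ + _); ring.
  apply/seteqP; split=> [_ [z /= e <-]|w /= w0]; first by rewrite xco_hpoint e subrr.
  by exists (g w) => //=; rewrite xco_hpoint w0 add0r.
have r0 : 0 < 2 * r%:num by rewrite mulr_gt0.
set f := inversion (c - r%:num) (2 * r%:num) (-1).
have norm (z : H2 R) := inversion_norm_gt0 (c - r%:num) z.
have xf z : xco (f z) = (r%:num ^+ 2 - ((xco z - c) ^+ 2 + yco z ^+ 2)) /
    ((xco z - (c - r%:num)) ^+ 2 + yco z ^+ 2).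
  by rewrite xco_inversion; have := norm z => n0; field; rewrite gt_eqF.
have fi : hisometry f by exact: inversion_isometry.
have onL z : points (Semicircle c r) z <-> xco (f z) = 0.
  rewrite xf /=; have := norm z => n0; split=> [->|/eqP].
    by rewrite subrr mul0r.
  by rewrite mulf_eq0 invr_eq0 (gt_eqF n0) orbF subr_eq0 => /eqP.
exists f.
  split=> //; apply/seteqP; split=> [_ [z /onL e <-]//|w /= w0].
  by have [z fz] := isometry_surj w fi; exists z => //; apply/onL; rewrite fz.
move=> z; rewrite /foot /foot_formula xf yco_inversion//.
have n0 := norm z.
by field; rewrite gt_eqF.
Qed.

(** * Perpendiculars as level sets of the foot *)

Lemma coshd_foot (R : realType) (f : H2 R -> H2 R) (L : geodesic R) z b :
  straightens f L -> points L b ->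
  coshd z b = (foot f z + yco (f b) ^+ 2) / (2 * yco (f z) * yco (f b)).
Proof.
move=> fL /(straightensP _ fL) e.
by rewrite -(isometry_coshd z b fL.1) /coshd e subr0.
Qed.

(** With W the foot of [z] and s the height of [f a], the distance from [z] to [a]
    increases with (W + s^2) / s, which is least exactly when s^2 = W. *)
Lemma foot_closest (R : realType) (f : H2 R -> H2 R) (L : geodesic R) z a :
  straightens f L -> points L a ->
  (forall b, points L b -> hdist z a <= hdist z b) <-> foot f a = foot f z.
Proof.
move=> fL La; have yz := yco_gt0 (f z).
have le b c : points L b -> points L c -> (hdist z b <= hdist z c) =
    ((foot f z + yco (f b) ^+ 2) * yco (f c) <= (foot f z + yco (f c) ^+ 2) * yco (f b)).
  move=> Lb Lc; have yb := yco_gt0 (f b); have yc := yco_gt0 (f c).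
  rewrite !hdistE ler_arcosh ?coshd_ge1// !(coshd_foot z fL)//.
  by rewrite ler_pdivrMr ?mulr_gt0// mulrAC ler_pdivlMr ?mulr_gt0//
    !mulrA ![_ * (2 : R)]mulrC -!mulrA ler_pM2l// ![_ * (yco (f z) * _)]mulrCA ler_pM2l.
rewrite (foot_on fL La); have ya := yco_gt0 (f a).
split=> [min|e b Lb]; last first.
  by rewrite le// -e; have := mulr_ge0 (ltW ya) (sqr_ge0 (yco (f b) - yco (f a))); nra.
have [b Lb eb] := foot_surj fL (foot_gt0 f z).
have yb := yco_gt0 (f b).
move: (min b Lb); rewrite le// -eb (foot_on fL Lb) => h.
suff -> : yco (f a) = yco (f b) by [].
have : 0 <= yco (f b) * - (yco (f a) - yco (f b)) ^+ 2 by nra.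
rewrite pmulr_rge0// oppr_ge0 => h2; apply/eqP.
by rewrite -subr_eq0 -sqrf_eq0 eq_le h2 sqr_ge0.
Qed.

(** An isometry need not be known to preserve angles: the level sets of the foot
    are described by distances alone, so they do not depend on [f]. *)
Lemma foot_level (R : realType) (f g : H2 R -> H2 R) (L : geodesic R) z w :
  straightens f L -> straightens g L ->
  foot f z = foot f w -> foot g z = foot g w.
Proof.
move=> fL gL e; have [a La ea] := foot_surj fL (foot_gt0 f z).
have min u : foot f a = foot f u -> foot g a = foot g u.
  by move=> h; apply/(foot_closest u gL La)/(foot_closest u fL La).
by rewrite -(min z)// -(min w)// ea.
Qed.

Lemma perpendicularC (R : realType) (G L : geodesic R) :
  perpendicular G L -> perpendicular L G.
Proof.
move=> [z [Gz Lz e]]; exists z; split=> //; move: e; rewrite /hinner.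
by rewrite (mulrC _ (tangent L z).1) (mulrC _ (tangent L z).2).
Qed.

Lemma hinner_eq0 (R : realType) (z : H2 R) (u v : R * R) :
  hinner z u v = 0 <-> u.1 * v.1 + u.2 * v.2 = 0.
Proof.
rewrite /hinner; split=> [/eqP|->]; last by rewrite mul0r.
by rewrite mulf_eq0 invr_eq0 expf_eq0 (gt_eqF (yco_gt0 z)) andbF orbF => /eqP.
Qed.

(** Two half circles with centres c, d and radii r, s are perpendicular when
    (c - d)^2 = r^2 + s^2; the one about d is then the circle of Apollonius of
    ratio (c + r - d) / (c - r - d) for the end points of the other. *)
Lemma perpendicular_level (R : realType) (N L : geodesic R) z w :
  perpendicular N L -> points N z ->
  points N w <-> foot_formula L w = foot_formula L z.
Proof.
case: L => [c|c r]; case: N => [d|d s]; move=> [q [/= Nq Lq /hinner_eq0/= e]].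
- lra.
- have -> : d = c by lra.
  by move=> ->.
- have ed : d = c by lra.
  have r0 : 0 < r%:num by [].
  have one u : (xco u = c) <-> ((xco u - (c + r%:num)) ^+ 2 + yco u ^+ 2) /
      ((xco u - (c - r%:num)) ^+ 2 + yco u ^+ 2) = 1.
    have nu := inversion_norm_gt0 (c - r%:num) u.
    have id : (xco u - (c + r%:num)) ^+ 2 + yco u ^+ 2 -
       ((xco u - (c - r%:num)) ^+ 2 + yco u ^+ 2) = 4 * r%:num * (c - xco u) by ring.
    split=> [e1|/(canRL (divfK (lt0r_neq0 nu))) h].
      apply/eqP; rewrite -(divff (lt0r_neq0 nu)) -subr_eq0 -mulrBl id e1.
      by rewrite subrr mulr0 mul0r.
    have /eqP : 4 * r%:num * (c - xco u) = 0 by rewrite -id h mul1r subrr.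
    by rewrite !mulf_eq0 (gt_eqF r0) pnatr_eq0/= subr_eq0 => /eqP.
  by rewrite {1}ed => /one ->; rewrite ed.
- have r0 : 0 < r%:num by [].
  have s0 : 0 < s%:num by [].
  have pyth : (c - d) ^+ 2 = r%:num ^+ 2 + s%:num ^+ 2 by nra.
  have m0 : (c + r%:num - d) * (c - r%:num - d) = s%:num ^+ 2 by nra.
  have n0 : c - r%:num - d != 0.
    by apply: contraTneq (exprn_gt0 2 s0) => h; rewrite -m0 h mulr0 ltxx.
  have lev u : points (Semicircle d s) u <->
      ((xco u - (c + r%:num)) ^+ 2 + yco u ^+ 2) /
      ((xco u - (c - r%:num)) ^+ 2 + yco u ^+ 2) = (c + r%:num - d) / (c - r%:num - d).
    have nu := inversion_norm_gt0 (c - r%:num) u.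
    have id : ((xco u - (c + r%:num)) ^+ 2 + yco u ^+ 2) * (c - r%:num - d) -
       (c + r%:num - d) * ((xco u - (c - r%:num)) ^+ 2 + yco u ^+ 2) =
       - 2 * r%:num * ((xco u - d) ^+ 2 + yco u ^+ 2 - s%:num ^+ 2).
      by rewrite -m0; ring.
    split=> [/= e1|/eqP].
      by apply/eqP; rewrite eqr_div ?(lt0r_neq0 nu)// -subr_eq0 id e1 subrr mulr0.
    rewrite eqr_div ?(lt0r_neq0 nu)// -subr_eq0 id.
    rewrite !mulf_eq0 (gt_eqF r0) oppr_eq0 pnatr_eq0/=.
    by rewrite subr_eq0 => /eqP.
  by move=> /lev ->; exact: lev.
Qed.

(** Besides the vertical cases, the centre d of the perpendicular half circle is
    determined by Pythagoras, (d - c)^2 = r^2 + s^2, with s the distance of [z]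
    from (d, 0). *)
Lemma perpendicular_exists (R : realType) (L : geodesic R) z :
  exists2 N, points N z & perpendicular N L.
Proof.
have yz := yco_gt0 z.
case: L => [c|c r].
  have s0 : 0 < Num.sqrt ((xco z - c) ^+ 2 + yco z ^+ 2).
    by rewrite sqrtr_gt0 inversion_norm_gt0.
  exists (Semicircle c (PosNum s0)) => /=.
    by rewrite sqr_sqrtr// ltW// inversion_norm_gt0.
  exists (hpoint c (Num.sqrt ((xco z - c) ^+ 2 + yco z ^+ 2))); split=> //=.
    by rewrite xco_hpoint yco_hpoint// subrr expr0n add0r.
  by apply/hinner_eq0; rewrite /= xco_hpoint subrr mulr0 mul0r addr0.
have r0 : 0 < r%:num by [].
have [zc|zc] := eqVneq (xco z) c.
  exists (Vertical c) => //; exists (hpoint c r%:num).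
  split; [by []|by rewrite /= xco_hpoint yco_hpoint// subrr expr0n add0r|].
  by apply/hinner_eq0; rewrite /= xco_hpoint subrr mulr0 mul0r addr0.
pose d := (c ^+ 2 - r%:num ^+ 2 - (xco z ^+ 2 + yco z ^+ 2)) / (2 * (c - xco z)).
have zc0 : c - xco z != 0 by rewrite subr_eq0 eq_sym.
pose s := Num.sqrt ((xco z - d) ^+ 2 + yco z ^+ 2).
have s0 : 0 < s by rewrite sqrtr_gt0 inversion_norm_gt0.
have s2 : s ^+ 2 = (xco z - d) ^+ 2 + yco z ^+ 2.
  by rewrite sqr_sqrtr// ltW// inversion_norm_gt0.
have pyth : (d - c) ^+ 2 = r%:num ^+ 2 + s ^+ 2.
  by rewrite s2 /d; field.
have dc : d - c != 0.
  rewrite -sqrf_eq0 pyth gt_eqF// addr_gt0 ?exprn_gt0//.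
exists (Semicircle d (PosNum s0)); first by rewrite /= s2.
pose h := r%:num * s / `|d - c|.
have h0 : 0 < h by rewrite divr_gt0 ?mulr_gt0 ?normr_gt0.
(* The two half circles meet at the point (c + r^2 / (d - c), h). *)
have h2 : h ^+ 2 = r%:num ^+ 2 * s ^+ 2 / (d - c) ^+ 2.
  by rewrite /h expr_div_n exprMn real_normK ?num_real.
exists (hpoint (c + r%:num ^+ 2 / (d - c)) h).
have es : s ^+ 2 = (d - c) ^+ 2 - r%:num ^+ 2 by rewrite pyth; ring.
split; last apply/hinner_eq0; rewrite /= xco_hpoint yco_hpoint// -?expr2 h2 es.
- by field.
- by field.
- by field.
Qed.

Lemma normalE (R : realType) (f : H2 R -> H2 R) (L : geodesic R) x z :
  straightens f L -> normal L x z <-> foot f z = foot f x.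
Proof.
move=> fL; have [g gL gE] := straighten_exists L.
have lev N : perpendicular N L -> points N x -> points N z <-> foot f z = foot f x.
  move=> NL Nx; rewrite (perpendicular_level z NL Nx) -!gE.
  by split; [exact: foot_level gL fL|exact: foot_level fL gL].
split=> [[N [Nx NL] Nz]|e]; first exact: (lev N NL Nx).1.
have [N Nx NL] := perpendicular_exists L x.
by exists N => //; exact: (lev N NL Nx).2.
Qed.

(** * Chords of the projective model and continuity *)

Lemma cont_cst (R : realType) (T : topologicalType) (c : R) :
  continuous (fun _ : T => c).
Proof. by move=> x; exact: cvg_cst. Qed.

Lemma cont_add (R : realType) (T : topologicalType) (f g : T -> R) :
  continuous f -> continuous g -> continuous (fun x => f x + g x).
Proof. by move=> cf cg x; exact: (cvgD (cf x) (cg x)). Qed.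

Lemma cont_sub (R : realType) (T : topologicalType) (f g : T -> R) :
  continuous f -> continuous g -> continuous (fun x => f x - g x).
Proof. by move=> cf cg x; exact: (cvgB (cf x) (cg x)). Qed.

Lemma cont_mul (R : realType) (T : topologicalType) (f g : T -> R) :
  continuous f -> continuous g -> continuous (fun x => f x * g x).
Proof. by move=> cf cg x; exact: (cvgM (cf x) (cg x)). Qed.

Lemma cont_div (R : realType) (T : topologicalType) (f g : T -> R) :
  continuous f -> continuous g -> (forall x, g x != 0) ->
  continuous (fun x => f x / g x).
Proof. by move=> cf cg g0 x; exact: (cvgM (cf x) (cvgV (g0 x) (cg x))). Qed.

Lemma cont_sqrt (R : realType) (T : topologicalType) (f : T -> R) :
  continuous f -> continuous (fun x => Num.sqrt (f x)).
Proof.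
by move=> cf x; exact: (continuous_comp (cf x) (@sqrt_continuous R (f x))).
Qed.

Lemma continuous_H2 (R : realType) (T : topologicalType) (F : T -> H2 R) :
  continuous (fun x => xco (F x)) -> continuous (fun x => yco (F x)) ->
  continuous F.
Proof.
move=> cx cy.
have : continuous (fun x => (xco (F x), yco (F x))).
  by move=> x; exact: (cvg_pair (cx x) (cy x)).
have -> : (fun x => (xco (F x), yco (F x))) = set_val \o F.
  by apply/funext => x /=; rewrite [RHS]surjective_pairing.
move=> h x; exact: (@continuous_comp_initial _ T _ (set_val : H2 R -> R * R) F h x).
Qed.

Lemma continuous_xco (R : realType) : continuous (@xco R).
Proof.
move=> z; apply: (@continuous_comp _ _ _ (set_val : H2 R -> R * R) fst).
  exact: initial_continuous.
exact: cvg_fst.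
Qed.

Lemma continuous_yco (R : realType) : continuous (@yco R).
Proof.
move=> z; apply: (@continuous_comp _ _ _ (set_val : H2 R -> R * R) snd).
  exact: initial_continuous.
exact: cvg_snd.
Qed.

Lemma continuous_affine (R : realType) (k : R * R * R) : continuous (affine k).
Proof.
have cx := @continuous_xco R; have cy := @continuous_yco R.
have c0 (c : R) := @cont_cst R (H2 R) c.
have cn := cont_add (cont_mul cx cx) (cont_mul cy cy).
exact (cont_add (cont_add (cont_mul (c0 k.1.1) cn) (cont_mul (c0 k.1.2) cx)) (c0 k.2)).
Qed.

Lemma continuous_foot (R : realType) (f : H2 R -> H2 R) :
  hisometry f -> continuous (foot f).
Proof.
move=> /foot_projective[A [B AB]].
have -> : foot f = (fun z => affine A z / affine B z).
  by apply/funext => z; have [] := AB z.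
apply: cont_div; try exact: continuous_affine.
by move=> z; have [_ /lt0r_neq0] := AB z.
Qed.

(** Clamping the parameter makes chords total and continuous on the whole line. *)
Definition clamp (R : realType) (t : R) : R := Num.max 0 (Num.min t 1).

Lemma clamp_bounds (R : realType) (t : R) : 0 <= clamp t <= 1.
Proof. by rewrite /clamp le_max lexx ge_max ler01 ge_min lexx orbT. Qed.

Lemma clamp_id (R : realType) (t : R) : 0 <= t <= 1 -> clamp t = t.
Proof. by move=> /andP[t0 t1]; rewrite /clamp min_l// max_r. Qed.

Lemma continuous_clamp (R : realType) : continuous (@clamp R).
Proof.
apply: max_fun_continuous; first exact: cont_cst.
by apply: min_fun_continuous; [move=> x; exact: cvg_id|exact: cont_cst].
Qed.

(** The squared height on a chord: v - u^2 at the point with parameter [s] on the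
    straight segment between the images of [z] and [w].  This form of it is visibly
    positive. *)
Definition ysq (R : realType) (z w : H2 R) (s : R) : R :=
  (1 - s) * yco z ^+ 2 + s * yco w ^+ 2 + s * (1 - s) * (xco z - xco w) ^+ 2.

(** The straight segment from [z] to [w] in the projective model, which traces the
    hyperbolic segment. *)
Definition chord (R : realType) (z w : H2 R) (t : R) : H2 R :=
  hpoint ((1 - clamp t) * xco z + clamp t * xco w) (Num.sqrt (ysq z w (clamp t))).

Lemma ysq_gt0 (R : realType) (z w : H2 R) (t : R) : 0 < ysq z w (clamp t).
Proof.
have /andP[s0 s1] := clamp_bounds t; move: (clamp t) s0 s1 => s s0 s1.
have yz : 0 < yco z ^+ 2 by rewrite exprn_gt0 ?yco_gt0.
have yw : 0 < yco w ^+ 2 by rewrite exprn_gt0 ?yco_gt0.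
apply: ltr_pwDl; last by rewrite mulr_ge0 ?sqr_ge0// mulr_ge0 ?subr_ge0.
have [->|s00] := eqVneq s 0; first by rewrite subr0 mul1r mul0r addr0.
have s_gt0 : 0 < s by rewrite lt0r s00.
by apply: ltr_wpDl; [rewrite mulr_ge0 ?subr_ge0 ?(ltW yz)|rewrite mulr_gt0].
Qed.

Lemma xco_chord (R : realType) (z w : H2 R) (t : R) :
  xco (chord z w t) = (1 - clamp t) * xco z + clamp t * xco w.
Proof. by []. Qed.

Lemma yco_chord (R : realType) (z w : H2 R) (t : R) :
  yco (chord z w t) = Num.sqrt (ysq z w (clamp t)).
Proof. by rewrite yco_hpoint// sqrtr_gt0 ysq_gt0. Qed.

Lemma affine_chord (R : realType) (k : R * R * R) (z w : H2 R) (t : R) :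
  0 <= t <= 1 ->
  affine k (chord z w t) = (1 - t) * affine k z + t * affine k w.
Proof.
move=> t01; rewrite /affine yco_chord sqr_sqrtr ?(ltW (ysq_gt0 _ _ _))// xco_chord.
by rewrite clamp_id// /ysq; ring.
Qed.

Lemma chord0 (R : realType) (z w : H2 R) : chord z w 0 = z.
Proof.
apply: H2_ext; rewrite ?xco_chord ?yco_chord clamp_id ?lexx ?ler01//; first ring.
rewrite /ysq subr0 mul1r !mul0r !addr0 sqrtr_sqr ger0_norm// ltW// yco_gt0//.
Qed.

Lemma chord1 (R : realType) (z w : H2 R) : chord z w 1 = w.
Proof.
apply: H2_ext; rewrite ?xco_chord ?yco_chord clamp_id ?lexx ?ler01//; first ring.
by rewrite /ysq subrr mul1r mulr0 !mul0r add0r addr0 sqrtr_sqr ger0_norm// ltW// yco_gt0.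
Qed.

Lemma continuous_chord (R : realType) (z w : H2 R) : continuous (chord z w).
Proof.
have c0 (c : R) := @cont_cst R R c; have cc := @continuous_clamp R.
have cB := cont_sub (c0 1) cc.
apply: continuous_H2.
  exact: (cont_add (cont_mul cB (c0 _)) (cont_mul cc (c0 _))).
have -> : (fun t => yco (chord z w t)) = (fun t => Num.sqrt (ysq z w (clamp t))).
  by apply/funext => t; rewrite yco_chord.
exact: (cont_sqrt (cont_add (cont_add (cont_mul cB (c0 _)) (cont_mul cc (c0 _)))
    (cont_mul (cont_mul cc cB) (c0 _)))).
Qed.

Lemma continuous_chordl (R : realType) (w : H2 R) (t : R) :
  continuous (fun z => chord z w t).
Proof.
have c0 (c : R) := @cont_cst R (H2 R) c.
have cx := @continuous_xco R; have cy := @continuous_yco R.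
have cB := cont_sub cx (c0 (xco w)).
apply: continuous_H2.
  exact: (cont_add (cont_mul (c0 _) cx) (c0 _)).
have -> : (fun z => yco (chord z w t)) = (fun z => Num.sqrt (ysq z w (clamp t))).
  by apply/funext => z; rewrite yco_chord.
exact: (cont_sqrt (cont_add (cont_add (cont_mul (c0 _) (cont_mul cy cy)) (c0 _))
    (cont_mul (c0 _) (cont_mul cB cB)))).
Qed.

(** * The foot along a chord *)

Lemma geodesic_affine (R : realType) (G : geodesic R) :
  exists k, forall z, points G z <-> affine k z = 0.
Proof.
case: G => [c|c r].
  by exists (0, 1, - c) => z; rewrite /affine /=; split=> h; lra.
exists (1, - 2 * c, c ^+ 2 - r%:num ^+ 2) => z; rewrite /affine /=.
by split=> h; nra.
Qed.

(** Completing the square makes the form a multiple of the equation of a half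
    circle; its squared radius is positive because the form vanishes at [q]. *)
Lemma affine_geodesic (R : realType) (k : R * R * R) (q : H2 R) :
  (k.1.1 != 0) || (k.1.2 != 0) -> affine k q = 0 ->
  exists G, forall z, points G z <-> affine k z = 0.
Proof.
case: k => [[a b] c]; rewrite /affine /= => ab0 q0.
have [a0|a0] := eqVneq a 0.
  move: ab0; rewrite a0 eqxx/= => b0; exists (Vertical (- c / b)) => z /=.
  rewrite mul0r add0r; split=> [->|h]; first by field.
  by apply: (mulfI b0); rewrite (mulrC _ (_ / _)) divfK//; lra.
pose d := - b / (2 * a).
have id z : a * (xco z ^+ 2 + yco z ^+ 2) + b * xco z + c =
    a * ((xco z - d) ^+ 2 + yco z ^+ 2 - (d ^+ 2 - c / a)).
  by rewrite /d; field.
have s2 : d ^+ 2 - c / a = (xco q - d) ^+ 2 + yco q ^+ 2.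
  apply/esym/eqP; rewrite -subr_eq0; move/eqP: q0; rewrite id mulf_eq0.
  by rewrite (negPf a0).
have s0 : 0 < Num.sqrt (d ^+ 2 - c / a) by rewrite sqrtr_gt0 s2 inversion_norm_gt0.
exists (Semicircle d (PosNum s0)) => z; rewrite id /= sqr_sqrtr; last first.
  by rewrite s2 ltW// inversion_norm_gt0.
split=> [->|/eqP]; first by rewrite subrr mulr0.
by rewrite mulf_eq0 (negPf a0)/= subr_eq0 => /eqP.
Qed.

Lemma geodesic_through (R : realType) (z w : H2 R) : z <> w ->
  exists G, points G z /\ points G w.
Proof.
move=> zw.
pose u := xco w - xco z.
pose v := xco w ^+ 2 + yco w ^+ 2 - (xco z ^+ 2 + yco z ^+ 2).
(* The straight line through the images of z and w. *)
pose k := (u, - v, v * xco z - u * (xco z ^+ 2 + yco z ^+ 2)).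
have kz : affine k z = 0 by rewrite /affine /k /=; ring.
have kw : affine k w = 0 by rewrite /affine /k /= /u /v; ring.
have [|G GE] := affine_geodesic (k := k) _ kz; last by exists G; split; apply/GE.
rewrite /= oppr_eq0 -negb_and; apply/negP => /andP[/eqP u0 /eqP v0]; apply: zw.
have ex : xco z = xco w by move: u0; rewrite /u; lra.
apply: H2_ext => //; apply/eqP.
rewrite -(eqrXn2 (n := 2))// ?ltW ?yco_gt0//; apply/eqP.
by move: v0; rewrite /v ex; lra.
Qed.

Lemma chord_geodesic (R : realType) (G : geodesic R) z w t :
  points G z -> points G w -> 0 <= t <= 1 -> points G (chord z w t).
Proof.
have [k kE] := geodesic_affine G; move=> /kE z0 /kE w0 t01; apply/kE.
by rewrite affine_chord// z0 w0 !mulr0 addr0.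
Qed.

(** A quotient of positive affine forms runs monotonically between its end values
    on a segment. *)
Lemma foot_chord (R : realType) (f : H2 R -> H2 R) z w t :
  hisometry f -> 0 <= t <= 1 ->
  exists s, [/\ 0 <= s <= 1, 0 < t -> 0 < s, t < 1 -> s < 1 &
    foot f (chord z w t) = (1 - s) * foot f z + s * foot f w].
Proof.
move=> /foot_projective[A [B AB]] /andP[t0 t1].
have [_ Bz fz] := AB z; have [_ Bw fw] := AB w; have [_ Bc ->] := AB (chord z w t).
have t01 : 0 <= t <= 1 by rewrite t0.
move: Bc; rewrite !affine_chord// fz fw; move: Bz Bw.
set b := affine B z; set b' := affine B w => b0 b0' c0.
exists (t * b' / ((1 - t) * b + t * b')).
have bt : 0 <= (1 - t) * b by rewrite mulr_ge0 ?subr_ge0 ?(ltW b0).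
have bt' : 0 <= t * b' by rewrite mulr_ge0 ?(ltW b0').
split.
- by rewrite divr_ge0 ?(ltW c0)//= ler_pdivrMr// mul1r lerDr.
- by move=> tp; rewrite divr_gt0// mulr_gt0.
- by move=> tp; rewrite ltr_pdivrMr// mul1r ltrDr mulr_gt0 ?subr_gt0.
- by clearbody b b'; field; rewrite !gt_eqF.
Qed.

Lemma foot_chord_between (R : realType) (f : H2 R -> H2 R) z w t :
  hisometry f -> 0 <= t <= 1 -> foot f z <= foot f w ->
  foot f z <= foot f (chord z w t) <= foot f w.
Proof.
move=> fi t01 zw; have [s [/andP[s0 s1] _ _ ->]] := foot_chord z w fi t01.
by apply/andP; split; nra.
Qed.

Lemma foot_chord_betweenC (R : realType) (f : H2 R -> H2 R) z w t :
  hisometry f -> 0 <= t <= 1 -> foot f w <= foot f z ->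
  foot f w <= foot f (chord z w t) <= foot f z.
Proof.
move=> fi t01 zw; have [s [/andP[s0 s1] _ _ ->]] := foot_chord z w fi t01.
by apply/andP; split; nra.
Qed.

Lemma affine_chord_zero (R : realType) (k : R * R * R) z w :
  affine k z <= 0 -> 0 <= affine k w ->
  exists2 t, 0 <= t <= 1 & affine k (chord z w t) = 0.
Proof.
move=> kz kw; have [e|e] := eqVneq (affine k w - affine k z) 0.
  by exists 0; rewrite ?lexx ?ler01// chord0; lra.
have d0 : 0 < affine k w - affine k z by rewrite lt0r e; lra.
have t01 : 0 <= - affine k z / (affine k w - affine k z) <= 1.
  rewrite divr_ge0 ?oppr_ge0 ?(ltW d0)//= ler_pdivrMr//; lra.
by exists (- affine k z / (affine k w - affine k z)) => //; rewrite affine_chord//; field.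
Qed.

(** Each level set of the foot is the zero set of an affine form, so the level can
    be found by solving a linear equation. *)
Lemma foot_chord_ivt (R : realType) (f : H2 R -> H2 R) z w r :
  hisometry f -> foot f z <= r <= foot f w ->
  exists2 t, 0 <= t <= 1 & foot f (chord z w t) = r.
Proof.
move=> /foot_projective[A [B AB]] /andP[zr rw].
pose k := (A.1.1 - r * B.1.1, A.1.2 - r * B.1.2, A.2 - r * B.2).
have kE x : affine k x = (foot f x - r) * affine B x.
  have [_ B0 ->] := AB x; rewrite mulrBl divfK ?gt_eqF//.
  by rewrite /k /affine /=; ring.
have B0 x : 0 < affine B x by have [] := AB x.
have [||t t01 kt] := @affine_chord_zero _ k z w.
- by rewrite kE pmulr_lle0// subr_le0.
- by rewrite kE pmulr_lge0// subr_ge0.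
exists t => //; move/eqP: kt; rewrite kE mulf_eq0 (gt_eqF (B0 _)) orbF.
by rewrite subr_eq0 => /eqP.
Qed.

(** * Convex bodies *)

Lemma convex_body_closed (R : realType) (K : set (H2 R)) :
  convex_body K -> closed K.
Proof. by move=> [[_ _ ->] _]; exact: closed_closure. Qed.

Lemma boundaryE (T : topologicalType) (K : set T) z : closed K ->
  boundary K z <-> K z /\ ~ interior K z.
Proof. by move=> /closure_id cK; rewrite /boundary -cK. Qed.

(** Otherwise the part of the chord in [K] would be both open and closed in the
    chord, which is connected. *)
Lemma boundary_crossing (R : realType) (K : set (H2 R)) z w : closed K ->
  K z -> ~ K w -> exists2 t, 0 <= t <= 1 & boundary K (chord z w t).
Proof.
move=> cK Kz Kw; apply: contrapT => nb.
have con : connected [set chord z w t | t in `[0, 1]].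
  apply: connected_continuous_connected; first exact: segment_connected.
  exact/continuous_subspaceT/continuous_chord.
have sub : [set chord z w t | t in `[0, 1]] `&` K `<=` interior K.
  move=> _ [[t /= t01 <-] Kt]; apply: contrapT => nI; apply: nb.
  by exists t; [move: t01; rewrite in_itv|exact/(boundaryE _ cK)].
have e : [set chord z w t | t in `[0, 1]] `&` K = [set chord z w t | t in `[0, 1]].
  apply: con.
  - exists z; split=> //; exists 0; last exact: chord0.
    by rewrite /= in_itv /= lexx ler01.
  - exists (interior K); first exact: open_interior.
    apply/seteqP; split=> x [Cx Kx]; first by split=> //; exact: sub.
    by split=> //; exact: interior_subset.
  - by exists K.
apply: Kw; have : [set chord z w t | t in `[0, 1]] w.
  by exists 1; [rewrite /= in_itv /= lexx ler01|exact: chord1].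
by rewrite -e => -[].
Qed.

Lemma foot_min (R : realType) (f : H2 R -> H2 R) (K : set (H2 R)) :
  hisometry f -> compact K -> K !=set0 ->
  exists2 c, K c & forall z, K z -> foot f c <= foot f z.
Proof.
move=> fi cK K0; have cf : {within K, continuous (foot f)}.
  exact/continuous_subspaceT/continuous_foot.
have [c Kc min] := compact_EVT_min K0 cK cf.
by exists c; [move: Kc; rewrite inE|move=> z Kz; apply: min; rewrite inE].
Qed.

Lemma foot_max (R : realType) (f : H2 R -> H2 R) (K : set (H2 R)) :
  hisometry f -> compact K -> K !=set0 ->
  exists2 c, K c & forall z, K z -> foot f z <= foot f c.
Proof.
move=> fi cK K0; have cf : {within K, continuous (foot f)}.
  exact/continuous_subspaceT/continuous_foot.
have [c Kc max] := compact_EVT_max K0 cK cf.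
by exists c; [move: Kc; rewrite inE|move=> z Kz; apply: max; rewrite inE].
Qed.

(** If the point y of parameter [t] were outside [K], there would be boundary
    points b1 between q and y, b2 between y and x, and b3 before q, since points of
    [G] with a very small foot lie outside the compact set [K].  They are distinct,
    so [K] has an arc of boundary points on [G], and this arc contains the interior
    point q between b3 and b1. *)
Lemma star_shaped_oriented (R : realType) (K : set (H2 R)) q x f G t :
  convex_body K -> interior K q -> K x -> straightens f G ->
  points G q -> points G x -> foot f q < foot f x -> 0 <= t <= 1 ->
  K (chord q x t).
Proof.
move=> cK Kq Kx fG Gq Gx qx t01; apply: contrapT; set y := chord q x t => nKy.
have fi := fG.1; have Kcl := convex_body_closed cK.
have Kq' : K q by exact: interior_subset.
have [[Kc _ _] Kgeo] := cK.
have sub z : boundary K z -> K z by move=> /(boundaryE _ Kcl)[].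
have Gy : points G y by exact: chord_geodesic.
have /andP[qy yx] := foot_chord_between fi t01 (ltW qx).
have [c Kc' cmin] := foot_min fi Kc (ex_intro _ _ Kq').
have [y3 Gy3 ey3] : exists2 y3, points G y3 & foot f y3 = foot f c / 2.
  by apply: foot_surj fG _; rewrite divr_gt0 ?foot_gt0.
have y3c : foot f y3 < foot f c by rewrite ey3; have := foot_gt0 f c; lra.
have nKy3 : ~ K y3 by move=> /cmin; rewrite leNgt y3c.
have y3q : foot f y3 <= foot f q by rewrite (le_trans (ltW y3c))// cmin.
have [t1 t101 bd1] := boundary_crossing Kcl Kq' nKy.
have [t2 t201 bd2] := boundary_crossing Kcl Kx nKy.
have [t3 t301 bd3] := boundary_crossing Kcl Kq' nKy3.
have G1 := chord_geodesic Gq Gy t101.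
have G2 := chord_geodesic Gx Gy t201.
have G3 := chord_geodesic Gq Gy3 t301.
have /andP[q1 y1] := foot_chord_between fi t101 qy.
have /andP[y2 _] := foot_chord_betweenC fi t201 yx.
have /andP[_ q3] := foot_chord_betweenC fi t301 y3q.
move: (chord q y t1) (chord x y t2) (chord q y3 t3) bd1 bd2 bd3 G1 G2 G3 q1 y1 y2 q3.
move=> b1 b2 b3 bd1 bd2 bd3 G1 G2 G3 q1 y1 y2 q3.
have notq b : boundary K b -> points G b -> foot f b <> foot f q.
  move=> bdb Gb /(foot_inj fG Gb Gq) e; move: bdb; rewrite e.
  by move=> /(boundaryE _ Kcl)[].
have lt1 : foot f q < foot f b1.
  by rewrite lt_neqAle q1 andbT; apply/eqP => /esym; exact: notq.
have lt3 : foot f b3 < foot f q.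
  by rewrite lt_neqAle q3 andbT; apply/eqP; exact: notq.
have lt12 : foot f b1 < foot f b2.
  rewrite lt_neqAle (le_trans y1 y2) andbT; apply/eqP => e.
  have e1 : foot f b1 = foot f y by apply/le_anti; rewrite y1 e y2.
  by apply: nKy; rewrite -(foot_inj fG G1 Gy e1); exact: sub.
have n13 : b1 <> b3 by move=> e; move: lt3; rewrite -e; lra.
have n12 : b1 <> b2 by move=> e; move: lt12; rewrite e ltxx.
have n23 : b2 <> b3 by move=> e; move: lt3 lt12 lt1; rewrite -e; lra.
have [[a [b ab]]|[a [b [_ ab]]]] := Kgeo G.
  have [h1|h1] := ab b1 (conj G1 bd1); have [h2|h2] := ab b2 (conj G2 bd2);
  have [h3|h3] := ab b3 (conj G3 bd3); move: h1 h2 h3 => /= h1 h2 h3; congruence.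
have on z : points G z -> boundary K z -> hsegment a b z by move=> ? ?; rewrite -ab.
suff : boundary K q by move=> /(boundaryE _ Kcl)[].
have [sa sb] := hsegment_ends a b.
have [Ga _] : (points G `&` boundary K) a by rewrite ab.
have [Gb _] : (points G `&` boundary K) b by rewrite ab.
have [] : (points G `&` boundary K) q; last by [].
have [lab|/ltW lab] := leP (foot f a) (foot f b).
  have [_ _ h1] := (hsegment_foot b1 fG Ga Gb lab).1 (on _ G1 bd1).
  have [_ h3 _] := (hsegment_foot b3 fG Ga Gb lab).1 (on _ G3 bd3).
  by rewrite ab; apply/(hsegment_foot q fG Ga Gb lab); split=> //; lra.
move: ab on; rewrite hsegmentC => ab on.
have [_ _ h1] := (hsegment_foot b1 fG Gb Ga lab).1 (on _ G1 bd1).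
have [_ h3 _] := (hsegment_foot b3 fG Gb Ga lab).1 (on _ G3 bd3).
by rewrite ab; apply/(hsegment_foot q fG Gb Ga lab); split=> //; lra.
Qed.

Lemma chord_id (R : realType) (z : H2 R) t : chord z z t = z.
Proof.
apply: H2_ext; rewrite ?xco_chord ?yco_chord; first ring.
rewrite /ysq subrr expr0n mulr0 addr0 -mulrDl subrK mul1r sqrtr_sqr.
by rewrite ger0_norm// ltW// yco_gt0.
Qed.

Lemma star_shaped (R : realType) (K : set (H2 R)) q x t :
  convex_body K -> interior K q -> K x -> 0 <= t <= 1 -> K (chord q x t).
Proof.
move=> cK Kq Kx t01; have [->|/eqP qx] := eqVneq q x; first by rewrite chord_id.
have [G [Gq Gx]] := geodesic_through qx.
have [f fG _] := straighten_exists G.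
have [lt|gt|e] := ltgtP (foot f q) (foot f x).
- exact: star_shaped_oriented fG _ _ lt t01.
- have [g gG gE] := foot_inv fG.
  apply: star_shaped_oriented gG _ _ _ t01 => //.
  by rewrite !gE ltf_pV2 ?posrE ?foot_gt0.
- by case: qx; exact: foot_inj fG Gq Gx e.
Qed.

(** Chords from interior points stay in [K], and [K] is the closure of these. *)
Lemma convex_body_chord (R : realType) (K : set (H2 R)) z w t :
  convex_body K -> K z -> K w -> 0 <= t <= 1 -> K (chord z w t).
Proof.
move=> cK Kz Kw t01; have [[_ _ Kint] _] := cK.
have : closed ((fun z => chord z w t) @^-1` K).
  apply: preimage_closed; last exact: convex_body_closed.
  by move=> x _; exact: continuous_chordl.
move=> /closure_id cl; suff : closure ((fun z => chord z w t) @^-1` K) z by rewrite -cl.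
have : closure (interior K) z by rewrite -Kint.
by apply: closure_subset => q Kq; exact: star_shaped.
Qed.

(** Moving slightly from [q] towards a point with smaller foot does not leave
    [K]. *)
Lemma interior_not_foot_min (R : realType) (K : set (H2 R)) f (L : geodesic R) q :
  straightens f L -> interior K q -> exists2 z, K z & foot f z < foot f q.
Proof.
move=> fL Kq.
have [y Ly ey] : exists2 y, points L y & foot f y = foot f q / 2.
  by apply: foot_surj fL _; rewrite divr_gt0 ?foot_gt0.
have yq : foot f y < foot f q by rewrite ey; have := foot_gt0 f q; lra.
have near0 : \forall t \near (0 : R)^'+, K (chord q y t).
  have : chord q y t @[t --> (0 : R)] --> chord q y 0 by exact: continuous_chord.
  rewrite chord0 => /(_ _ Kq) h; exact: cvg_at_right_filter h.
have : \forall t \near (0 : R)^'+, t < 1 by exact: nbhs_right_lt.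
have : \forall t \near (0 : R)^'+, 0 < t by exact: nbhs_right_gt.
move=> p0 p1.
have [t [Kt [t0 t1]]] : exists t, K (chord q y t) /\ 0 < t /\ t < 1.
  near (0 : R)^'+ => t; exists t.
  by split; [|split]; near: t; [exact: near0|exact: p0|exact: p1].

exists (chord q y t) => //.
have t01 : 0 <= t <= 1 by rewrite !ltW.
have [s [_ /(_ t0) s0 _ ->]] := foot_chord q y fL.1 t01.
by nra.
Unshelve. all: by end_near.
Qed.

Lemma interior_not_foot_max (R : realType) (K : set (H2 R)) f (L : geodesic R) q :
  straightens f L -> interior K q -> exists2 z, K z & foot f q < foot f z.
Proof.
move=> fL Kq; have [g gL gE] := foot_inv fL.
have [z Kz] := interior_not_foot_min gL Kq.
by rewrite !gE ltf_pV2 ?posrE ?foot_gt0//; exists z.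
Qed.

Lemma closed_geodesic (R : realType) (G : geodesic R) : closed (points G).
Proof.
have [k kE] := geodesic_affine G.
have -> : points G = affine k @^-1` [set 0] by apply/seteqP; split=> z /kE.
apply: preimage_closed; last exact: closed_eq.
by move=> z _; exact: continuous_affine.
Qed.

(** The foot on [G] itself is a coordinate along [G]; by compactness and convexity
    the section is the range between its extreme values. *)
Lemma geodesic_section (R : realType) (K : set (H2 R)) (G : geodesic R) :
  convex_body K -> (points G `&` K) !=set0 ->
  exists a b, points G `&` K = hsegment a b.
Proof.
move=> cK GK0; have [[Kc _ _] _] := cK.
have [f fG _] := straighten_exists G; have fi := fG.1.
have GKc : compact (points G `&` K).
  by rewrite setIC; apply: compact_closedI => //; exact: closed_geodesic.
have [a [Ga Ka] amin] := foot_min fi GKc GK0.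
have [b [Gb Kb] bmax] := foot_max fi GKc GK0.
have ab : foot f a <= foot f b by exact: amin.
exists a, b; apply/seteqP; split=> z.
  move=> GKz; apply/(hsegment_foot z fG Ga Gb ab).
  by split; [case: GKz|exact: amin|exact: bmax].
move=> /(hsegment_foot z fG Ga Gb ab)[Gz az zb]; split=> //.
have [||t t01 e] := @foot_chord_ivt _ f a b (foot f z) => //; first by rewrite az.
rewrite -(foot_inj fG (chord_geodesic Ga Gb t01) Gz e).
exact: convex_body_chord.
Qed.

Lemma hsegment_refl (R : realType) (a : H2 R) : hsegment a a = [set a].
Proof.
apply/seteqP; split=> z; last first.
  by move=> ->; have [] := hsegment_ends a a.
rewrite hsegment_vertical// => -[ex h1 h2]; apply: H2_ext => //.
by apply/le_anti; rewrite h1 h2.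
Qed.

(** At the level of least foot, [N] contains no interior points of [K], so its
    boundary points are its whole section with [K], a segment or a point. *)
Lemma extreme_normal_supporting (R : realType) (K : set (H2 R)) f (L N : geodesic R) z :
  convex_body K -> straightens f L -> perpendicular N L -> points N z -> K z ->
  (forall w, K w -> foot f z <= foot f w) -> supporting K N.
Proof.
move=> cK fL NL Nz Kz zmin; have Kcl := convex_body_closed cK.
have lev w : points N w -> foot f w = foot f z.
  by move=> Nw; apply/(normalE z w fL); exists N.
have bd : points N `&` boundary K = points N `&` K.
  apply/seteqP; split=> w [Nw]; first by move=> /(boundaryE _ Kcl)[].
  move=> Kw; split=> //; apply/(boundaryE _ Kcl); split=> // Iw.
  have [v Kv] := interior_not_foot_min fL Iw.
  by rewrite (lev _ Nw) ltNge zmin.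
have [|a [b ab]] := @geodesic_section _ K N cK; first by exists z.
have [eab|nab] := pselect (a = b).
  by left; exists a; rewrite bd ab eab hsegment_refl.
by right; exists a, b; rewrite bd.
Qed.

(** The perpendicular bisector, in the Euclidean geometry of the coordinates
    (x, x^2 + y^2), of the segment from [x] to its nearest point in [K].  It does
    define a geodesic because it crosses a chord from [x] to a point of [K]. *)
Lemma separating_geodesic (R : realType) (K : set (H2 R)) x :
  convex_body K -> K !=set0 -> ~ K x ->
  exists k (G : geodesic R), [/\ (forall z, points G z <-> affine k z = 0),
    affine k x < 0 & forall z, K z -> 0 < affine k z].
Proof.
move=> cK K0 nKx; have [[Kc _ _] _] := cK.
pose v (z : H2 R) := xco z ^+ 2 + yco z ^+ 2.
pose sq z := (xco z - xco x) ^+ 2 + (v z - v x) ^+ 2.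
have csq : continuous sq.
  have cx := @continuous_xco R; have cy := @continuous_yco R.
  have c0 (c : R) := @cont_cst R (H2 R) c.
  have cv := cont_add (cont_mul cx cx) (cont_mul cy cy).
  have c1 := cont_sub cx (c0 (xco x)); have c2 := cont_sub cv (c0 (v x)).
  exact (cont_add (cont_mul c1 c1) (cont_mul c2 c2)).
have [y Ky ymin] := compact_EVT_min K0 Kc (continuous_subspaceT csq).
rewrite inE in Ky.
pose a := v y - v x; pose b := xco y - xco x.
have d0 : 0 < a ^+ 2 + b ^+ 2.
  rewrite lt0r paddr_eq0 ?sqr_ge0// addr_ge0 ?sqr_ge0// andbT !sqrf_eq0.
  apply/negP => /andP[/eqP a0 /eqP b0]; apply: nKx; suff -> : x = y by [].
  have ex : xco x = xco y by move: b0; rewrite /b; lra.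
  apply: H2_ext => //; apply/eqP.
  rewrite -(eqrXn2 (n := 2))// ?(ltW (yco_gt0 _))//; apply/eqP.
  by move: a0; rewrite /a /v ex; lra.
pose k := (a, b, - (a * (v y + v x) / 2 + b * (xco y + xco x) / 2)).
have kE z : affine k z = a * (v z - v y) + b * (xco z - xco y) + (a ^+ 2 + b ^+ 2) / 2.
  by rewrite /affine /k /= -/(v z) /a /b; field.
have kx : affine k x = - ((a ^+ 2 + b ^+ 2) / 2) by rewrite kE /a /b; field.
have kpos z : K z -> 0 < affine k z.
  move=> Kz; rewrite kE; suff : 0 <= a * (v z - v y) + b * (xco z - xco y) by lra.
  rewrite leNgt; apply/negP.
  set m := _ + _ => m0.
  pose c := (v z - v y) ^+ 2 + (xco z - xco y) ^+ 2.
  have c0 : 0 <= c by rewrite addr_ge0 ?sqr_ge0.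
  have along t : 0 <= t <= 1 -> 0 <= 2 * t * m + t ^+ 2 * c.
    move=> t01; have /ymin : chord y z t \in K.
      by rewrite inE; exact: convex_body_chord.
    have ev : v (chord y z t) = (1 - t) * v y + t * v z.
      have := affine_chord (1, 0, 0) y z t01.
      by rewrite /affine /= !mul1r !mul0r !addr0.
    by rewrite /sq ev xco_chord clamp_id// /m /c /a /b => h; nra.
  have cm : 0 < c - m by lra.
  have t01 : 0 <= - m / (c - m) <= 1.
    by rewrite divr_ge0 ?(ltW cm) ?oppr_ge0 ?(ltW m0)//= ler_pdivrMr//; lra.
  have := along _ t01; apply/negP; rewrite -ltNge.
  have -> : 2 * (- m / (c - m)) * m + (- m / (c - m)) ^+ 2 * c =
    (m / (c - m)) ^+ 2 * (2 * m - c) by field; rewrite gt_eqF.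
  rewrite pmulr_rlt0; first by lra.
  by rewrite exprn_even_gt0//= mulf_neq0 ?invr_neq0 ?(lt0r_neq0 cm) ?(ltr0_neq0 m0).
have kx0 : affine k x < 0 by rewrite kx; lra.
have [t t01 kt] := affine_chord_zero (ltW kx0) (ltW (kpos _ Ky)).
have [|G GE] := affine_geodesic (k := k) _ kt; last by exists k, G.
rewrite /= -negb_and; apply/negP => /andP[/eqP a0 /eqP b0].
by move: d0; rewrite a0 b0 expr0n addr0 ltxx.
Qed.

(** * Projection lengths *)

(** The end points of a segment can be recovered from it as its lowest and highest
    points, so the choice made by [hlength] is immaterial. *)
Lemma hlength_vertical (R : realType) (f : H2 R -> H2 R) (c y1 y2 : R) :
  hisometry f -> 0 < y1 -> y1 <= y2 ->
  hlength [set z | xco (f z) = c /\ y1 <= yco (f z) <= y2] = ln y2 - ln y1.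
Proof.
move=> fi y1_gt0 y12; have y2_gt0 := lt_le_trans y1_gt0 y12.
set A := [set z | _].
have [a fa] := isometry_surj (hpoint c y1) fi.
have [b fb] := isometry_surj (hpoint c y2) fi.
have xa : xco (f a) = c by rewrite fa.
have ya : yco (f a) = y1 by rewrite fa yco_hpoint.
have xb : xco (f b) = c by rewrite fb.
have yb : yco (f b) = y2 by rewrite fb yco_hpoint.
have segE u v : xco (f u) = c -> xco (f v) = c -> yco (f u) <= yco (f v) ->
    hsegment u v = [set z | xco (f z) = c /\ yco (f u) <= yco (f z) <= yco (f v)].
  move=> xu xv uv; have xuv : xco (f u) = xco (f v) by rewrite xu.
  apply/seteqP; split=> z.
    move=> /(isometry_hsegment u v z fi) /(@hsegment_vertical _ _ _ (f z) xuv uv).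
    by rewrite xu => -[xz uz zv]; split=> //; rewrite uz.
  move=> /= [xz /andP[uz zv]]; apply/(isometry_hsegment u v z fi).
  by apply/(@hsegment_vertical _ _ _ (f z) xuv uv); rewrite xu.
have lenE u v : A u -> A v -> yco (f u) <= yco (f v) -> A = hsegment u v ->
    hdist u v = ln y2 - ln y1.
  move=> Au Av uv Auv; have [xu /andP[u1 u2]] := Au; have [xv /andP[v1 v2]] := Av.
  have Aa : A a by rewrite /A /= xa ya lexx y12.
  have Ab : A b by rewrite /A /= xb yb lexx y12.
  move: Aa Ab; rewrite Auv (segE u v)//= ya yb => -[_ /andP[ua _]] [_ /andP[_ bv]].
  have eu : yco (f u) = y1 by apply/le_anti; rewrite ua u1.
  have ev : yco (f v) = y2 by apply/le_anti; rewrite bv v2.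
  have [_ fd] := fi; rewrite -fd hdist_vertical ?xu ?xv// eu ev distrC ger0_norm//.
  by rewrite subr_ge0 ler_ln.
apply: xget_unique.
  exists a, b; split; first by rewrite segE ?xa ?xb ?ya ?yb.
  apply/esym/lenE; rewrite ?ya ?yb ?segE /A /= ?xa ?xb ?ya ?yb ?lexx ?y12//.
move=> _ [u [v [Auv ->]]].
have [su sv] := hsegment_ends u v.
have Au : A u by rewrite Auv.
have Av : A v by rewrite Auv.
have [uv|/ltW vu] := leP (yco (f u)) (yco (f v)); first exact: lenE.
by rewrite hdistC; apply: lenE => //; rewrite hsegmentC.
Qed.

Lemma hlength_foot_range (R : realType) (f : H2 R -> H2 R) (s m M : R) :
  hisometry f -> s ^+ 2 < m -> m <= M ->
  hlength [set z | xco (f z) = s /\ m <= foot f z <= M] =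
  ln (Num.sqrt (M - s ^+ 2)) - ln (Num.sqrt (m - s ^+ 2)).
Proof.
move=> fi sm mM; have m0 : 0 < m - s ^+ 2 by rewrite subr_gt0.
have M0 : 0 < M - s ^+ 2 by rewrite subr_gt0 (lt_le_trans sm).
rewrite -(hlength_vertical s fi) ?sqrtr_gt0 ?ler_wsqrtr ?lerB//.
have yf z := yco_gt0 (f z).
have sq z : Num.sqrt (yco (f z) ^+ 2) = yco (f z) by rewrite sqrtr_sqr ger0_norm// ltW.
congr hlength; apply/seteqP; split=> z /= [xz].
  rewrite /foot xz => /andP[h1 h2]; split=> //.
  by rewrite -sq !ler_wsqrtr//; lra.
rewrite -[in X in X -> _]sq !ler_sqrt ?exprn_ge0 ?(ltW (yf z)) ?(ltW M0)//.
by rewrite /foot xz => /andP[h1 h2]; split=> //; apply/andP; split; lra.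
Qed.

(** The numbers m and M are the extreme feet of points of [K].  The perpendicular
    at level m supports [K], so it meets the companion line, which forces
    t^2 < m: every perpendicular that meets [K] crosses the companion line. *)
Lemma projection_lengths (R : realType) (K : set (H2 R)) p f (L : geodesic R) t :
  convex_body K -> interior K p -> straightens f L ->
  (forall G, supporting K G -> perpendicular G L ->
    (companion f t `&` points G) !=set0) ->
  exists m M, [/\ t ^+ 2 < m, m < M,
    forall x, (K `&` normal L x) !=set0 <-> m <= foot f x <= M,
    hlength (orthogonal_projection L K) = ln (Num.sqrt M) - ln (Num.sqrt m) &
    hlength (projection_along L (companion f t) K) =
      ln (Num.sqrt (M - t ^+ 2)) - ln (Num.sqrt (m - t ^+ 2))].
Proof.
move=> cK Kp fL meets; have fi := fL.1; have [[Kc _ _] _] := cK.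
have K0 : K !=set0 by exists p; exact: interior_subset.
have [a Ka amin] := foot_min fi Kc K0; have [b Kb bmax] := foot_max fi Kc K0.
have hit x : (K `&` normal L x) !=set0 <-> foot f a <= foot f x <= foot f b.
  split=> [[z [Kz /(normalE x z fL) <-]]|ax]; first by rewrite amin// bmax.
  have [c c01 e] := foot_chord_ivt fi ax.
  by exists (chord a b c); split; [exact: convex_body_chord|exact/(normalE x _ fL)].
have ab : foot f a < foot f b.
  have [z Kz pz] := interior_not_foot_max fL Kp.
  by rewrite (le_lt_trans (amin _ (interior_subset Kp)))// (lt_le_trans pz)// bmax.
have ta : t ^+ 2 < foot f a.
  have [N Na NL] := perpendicular_exists L a.
  have [w [wt Nw]] := meets N (extreme_normal_supporting cK fL NL Na Ka amin) NL.
  have <- : foot f w = foot f a by apply/(normalE a w fL); exists N.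
  by rewrite /foot; move: wt => /= ->; rewrite ltrDl exprn_gt0// yco_gt0.
exists (foot f a), (foot f b); split=> //.
  have -> : orthogonal_projection L K =
      [set z | xco (f z) = 0 /\ foot f a <= foot f z <= foot f b].
    by apply/seteqP; split=> z [/(straightensP z fL) Lz /hit zab].
  by rewrite hlength_foot_range// ?expr0n ?subr0 ?foot_gt0// ltW.
have -> : projection_along L (companion f t) K =
    [set z | xco (f z) = t /\ foot f a <= foot f z <= foot f b].
  by apply/seteqP; split=> z [Lz /hit zab].
by rewrite hlength_foot_range// ltW.
Qed.

(** Lengths enter as differences of logarithms of radii, that is of square roots. *)
Lemma ln_sqrt_ratio (R : realType) (a b c d : R) :
  0 < a -> 0 < b -> 0 < c -> 0 < d ->
  ln (Num.sqrt a) - ln (Num.sqrt b) = ln (Num.sqrt c) - ln (Num.sqrt d) ->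
  a * d = c * b.
Proof.
move=> a0 b0 c0 d0 e.
have : ln (Num.sqrt (a * d)) = ln (Num.sqrt (c * b)).
  by rewrite !sqrtrM ?ltW// !lnM ?posrE ?sqrtr_gt0//; lra.
move=> /ln_inj; rewrite !posrE !sqrtr_gt0 !mulr_gt0// => /(_ isT isT) /eqP.
by rewrite eqr_sqrt ?mulr_ge0 ?ltW// => /eqP.
Qed.

(** A point [x] of [K2] outside [K1] is separated from [K1] by some geodesic [G].
    Take [L] through [p] perpendicular to [G].  The perpendicular to [L] through
    [x] meets [K1] at some [z] by assumption, so it crosses [G]; being a level set
    of the foot, as [G] is, it coincides with [G], which does not contain [x]. *)
Lemma projections_determine (R : realType) (K1 K2 : set (H2 R)) p :
  convex_body K1 -> K1 !=set0 ->
  (forall L x, points L p -> (K2 `&` normal L x) !=set0 ->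
    (K1 `&` normal L x) !=set0) ->
  K2 `<=` K1.
Proof.
move=> cK1 K10 sub x Kx; apply: contrapT => nKx.
have [k [G [GE kx kpos]]] := separating_geodesic cK1 K10 nKx.
have [L Lp /perpendicularC GL] := perpendicular_exists G p.
have [f fL fE] := straighten_exists L.
have [|z [Kz /(normalE x z fL) e]] := sub L x Lp.
  by exists x; split=> //; apply/(normalE x x fL).
have [t t01 kt] := affine_chord_zero (ltW kx) (ltW (kpos _ Kz)).
have Gc : points G (chord x z t) by apply/GE.
have ec : foot f x = foot f (chord x z t).
  have xz : foot f x <= foot f z by rewrite e.
  by apply/le_anti; have := foot_chord_between fL.1 t01 xz; rewrite e andbC.
have /GE kx0 : points G x by apply/(perpendicular_level x GL Gc); rewrite -!fE.
by rewrite kx0 ltxx in kx.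
Qed.

Theorem proposition4p8 (R : realType) (p : H2 R)
  (psi : geodesic R -> H2 R -> H2 R)
  (psi_isometry : forall L : geodesic R, points L p -> hisometry (psi L))
  (psi_image : forall L : geodesic R, points L p ->
     psi L @` points L = points (Vertical 0))
  (K1 K2 : set (H2 R))
  (K1_convex : convex_body K1) (K2_convex : convex_body K2)
  (p_in_K1 : interior K1 p) (p_in_K2 : interior K2 p)
  (t : R) (t_gt0 : 0 < t)
  (meets1 : forall L G : geodesic R, points L p ->
     supporting K1 G -> perpendicular G L ->
     (companion (psi L) t `&` points G) !=set0)
  (meets2 : forall L G : geodesic R, points L p ->
     supporting K2 G -> perpendicular G L ->
     (companion (psi L) t `&` points G) !=set0)
  (eq_orthogonal : forall L : geodesic R, points L p ->
     hlength (orthogonal_projection L K1) = hlength (orthogonal_projection L K2))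
  (eq_nonorthogonal : forall L : geodesic R, points L p ->
     hlength (projection_along L (companion (psi L) t) K1) =
     hlength (projection_along L (companion (psi L) t) K2)) :
  K1 = K2.
Proof.
have same L x : points L p ->
    (K1 `&` normal L x) !=set0 <-> (K2 `&` normal L x) !=set0.
  move=> Lp; have fL : straightens (psi L) L.
    by split; [exact: psi_isometry|exact: psi_image].
  have [m1 [M1 [tm1 mM1 hit1 orth1 nonorth1]]] :=
    projection_lengths K1_convex p_in_K1 fL (fun G => meets1 L G Lp).
  have [m2 [M2 [tm2 mM2 hit2 orth2 nonorth2]]] :=
    projection_lengths K2_convex p_in_K2 fL (fun G => meets2 L G Lp).
  have t2 : 0 < t ^+ 2 by rewrite exprn_gt0.
  have e1 : M1 * m2 = M2 * m1.
    by apply: ln_sqrt_ratio; rewrite -?orth1 -?orth2 ?eq_orthogonal//; lra.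
  have e2 : (M1 - t ^+ 2) * (m2 - t ^+ 2) = (M2 - t ^+ 2) * (m1 - t ^+ 2).
    apply: ln_sqrt_ratio; rewrite -?nonorth1 -?nonorth2 ?eq_nonorthogonal//; lra.
  (* The difference of e1 and e2 is t^2 times this equation. *)
  have e3 : M1 - m1 = M2 - m2.
    by apply: (mulfI (lt0r_neq0 t2)); nra.
  have em : m1 = m2.
    by apply: (mulIf (x := M1 - m1)); [rewrite subr_eq0 gt_eqF|nra].
  have eM : M1 = M2 by lra.
  by rewrite hit1 hit2 em eM.
have K1_nonempty : K1 !=set0 by exists p; exact: interior_subset.
have K2_nonempty : K2 !=set0 by exists p; exact: interior_subset.
apply/seteqP; split.
  apply: (projections_determine K2_convex K2_nonempty (p := p)) => L x Lp.
  by move=> /(same L x Lp).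
apply: (projections_determine K1_convex K1_nonempty (p := p)) => L x Lp.
by move=> /(same L x Lp).
Qed.
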